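(* Let $Q$ be an $n$-dimensional manifold with local coordinates $(q^1,\ldots,q^n)$, let $\tilde Q=Q\times\mathbb R$ with coordinate $q^{n+1}$ on $\mathbb R$, and equip $T^*\tilde Q$ with the symplectic form $\tilde\omega=\sum_{i=1}^{n+1}dp_i\wedge dq^i$. Let $$\mathcal L^{(n+1)}(\boldsymbol q,\boldsymbol p)=\begin{pmatrix} S_{11}(q^1)&\cdots&S_{1n}(q^1)&S_{1,n+1}(q^1,p_1)\\ \vdots&\ddots&\vdots&\vdots\\ S_{n1}(q^n)&\cdots&S_{nn}(q^n)&S_{n,n+1}(q^n,p_n)\\ 0&\cdots&0&S_{n+1,n+1}(q^{n+1})\end{pmatrix},$$ where $S^{(n)}=(S_{ij}(q^i))_{i,j=1}^n$ is an invertible matrix of smooth functions, $S_{1,n+1}(q^1,p_1),\ldots,S_{n,n+1}(q^n,p_n)$ are arbitrary smooth functions, and $S_{n+1,n+1}(q^{n+1})\neq0$. Let $(H_1,\ldots,H_{n+1})$ be the Stäckel-lifted Hamiltonian system on $T^*\tilde Q$ defined by $$\begin{pmatrix}H_1\\ \vdots\\ H_{n+1}\end{pmatrix}=(\mathcal L^{(n+1)})^{-1}(\boldsymbol q,\boldsymbol p)\begin{pmatrix}f_1(q^1,p_1)\\ \vdots\\ f_{n+1}(q^{n+1},p_{n+1})\end{pmatrix},$$ with $f_1,\ldots,f_{n+1}$ arbitrary smooth functions. Let $\tilde{\mathcal L}_{jr}$ denote the cofactor associated with the element $\mathcal L_{rj}$ (row $r$, column $j$) of $\mathcal L^{(n+1)}$,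 and restrict to the open subset of $T^*\tilde Q$ where $\tilde{\mathcal L}_{1r}\neq0$ for $r=1,\ldots,n+1$ and where $H_1$ depends on all the momenta, i.e. $\partial H_1/\partial p_r\neq0$ for $r=1,\ldots,n+1$. Then there exists an $\omega\mathscr H$ manifold (on this open subset, with symplectic form $\tilde\omega$) associated with $(H_1,\ldots,H_{n+1})$, whose Haantjes algebra $\mathscr H$ is defined by the set of semisimple operators $$\boldsymbol K_j=\sum_{r=1}^{n+1}\mu_{jr}\left(\frac{\partial}{\partial q^r}\otimes dq^r+\frac{\partial}{\partial p_r}\otimes dp_r\right),\qquad j=1,\ldots,n+1,$$ where $$\mu_{jr}=\mu_{jr}(q^1,\ldots,q^n,p_1,\ldots,p_n)=\frac{\tilde{\mathcal L}_{jr}}{\tilde{\mathcal L}_{1r}}.$$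
   Context: All objects are smooth. For a $(1,1)$-tensor field $\boldsymbol K$ on a manifold $M$, viewed as $\boldsymbol K:\mathfrak X(M)\to\mathfrak X(M)$, the Nijenhuis torsion is $$\tau_{\boldsymbol K}(X,Y)=\boldsymbol K^2[X,Y]+[\boldsymbol KX,\boldsymbol KY]-\boldsymbol K\big([X,\boldsymbol KY]+[\boldsymbol KX,Y]\big),$$ and the Haantjes torsion is $$\mathcal H_{\boldsymbol K}(X,Y)=\boldsymbol K^2\tau_{\boldsymbol K}(X,Y)+\tau_{\boldsymbol K}(\boldsymbol KX,\boldsymbol KY)-\boldsymbol K\big(\tau_{\boldsymbol K}(X,\boldsymbol KY)+\tau_{\boldsymbol K}(\boldsymbol KX,Y)\big).$$ $\boldsymbol K$ is a Haantjes operator if $\mathcal H_{\boldsymbol K}\equiv0$. ''Semisimple'' means pointwise diagonalizable. A Haantjes algebra $(M,\mathscr H)$ is a set $\mathscr H$ of Haantjes operators on $M$ generating a free module over $C^\infty(M)$ (so $\mathcal H_{f\boldsymbol K_1+g\boldsymbol K_2}=0$ for all $\boldsymbol K_1,\boldsymbol K_2\in\mathscr H$ and $f,g\in C^\infty(M)$) and a ring under composition (so $\mathcal H_{\boldsymbol K_1\boldsymbol K_2}=0$ for all $\boldsymbol K_1,\boldsymbol K_2\in\mathscr H$). It is Abelian if $\boldsymbol K_1\boldsymbol K_2=\boldsymbol K_2\boldsymbol K_1$ for all $\boldsymbol K_1,\boldsymbol K_2\in\mathscr H$. Its rank is its rank as a module. Here, ''$\mathscr H$ is defined by the set $\{\boldsymbol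 K_1,\ldots,\boldsymbol K_{n+1}\}$'' means that these operators form a basis of $\mathscr H$ as a $C^\infty$-module. A symplectic-Haantjes (or $\omega\mathscr H$) manifold of class $m$ is a triple $(M,\omega,\mathscr H)$ where $(M,\omega)$ is a symplectic manifold, $\mathscr H$ is an Abelian Haantjes algebra of rank $m$, and $\omega(X,\boldsymbol KY)=\omega(\boldsymbol KX,Y)$ for all $\boldsymbol K\in\mathscr H$ and all vector fields $X,Y$. A function $H$ generates a Haantjes chain of length $m$ if there is a basis $\{\boldsymbol K_1,\ldots,\boldsymbol K_m\}$ of $\mathscr H$ such that the 1-forms $\boldsymbol K_\alpha^T\,dH$ ($\boldsymbol K^T$ being the transposed operator acting on 1-forms) are closed and linearly independent; functions $H_\alpha$ with $dH_\alpha=\boldsymbol K_\alpha^T\,dH$ are the potential functions of the chain. The $\omega\mathscr H$ manifold being ''associated'' with $(H_1,\ldots,H_{n+1})$ means that these Hamiltonians are the potential functions of the Haantjes chain generated by $H_1$ via the operators $\boldsymbol K_j$, i.e. $dH_j=\boldsymbol K_j^T\,dH_1$ for $j=1,\ldots,n+1$. *)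

(* Defs.v *)
From HB Require Import structures.
From mathcomp Require Import all_boot all_order all_algebra.
From mathcomp Require Import all_classical all_reals all_analysis.

Set Implicit Arguments.
Unset Strict Implicit.
Unset Printing Implicit Defensive.

Import Order.TTheory GRing.Theory Num.Theory.
Import numFieldNormedType.Exports.

Local Open Scope classical_set_scope.
Local Open Scope ring_scope.

(** Geometry on an open subset U of R^N.

    Points and tangent vectors are columns, covectors are rows, and a
    (1,1)-tensor is a square matrix acting on columns from the left.  A tensor
    field on U is represented by a total function on R^N; only its restriction
    to U is meaningful, and every notion below depends only on that restriction
    as soon as U is open. *)

Section Smooth.
Context {R : realType} {V W : normedModType R}.

Fixpoint Ck (k : nat) (U : set V) (f : V -> W) : Prop :=
  match k with
  | 0%N => forall x, U x -> {for x, continuous f}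
  | k'.+1 => (forall x, U x -> differentiable f x) /\
             (forall v : V, Ck k' U (fun x => 'D_v f x))
  end.

Definition smooth_on (U : set V) (f : V -> W) : Prop := forall k, Ck k U f.

End Smooth.

Section Fields.
Context {R : realType} {N : nat}.

Local Notation space := 'cV[R]_N.
Definition vector_field : Type := space -> 'cV[R]_N.
Definition one_form : Type := space -> 'rV[R]_N.
Definition tensor11 : Type := space -> 'M[R]_N.

(* The matrix w x of a covariant 2-tensor field w is its Gram matrix:
   w(X, Y) = X^T w Y. *)
Definition tensor02 : Type := space -> 'M[R]_N.

Implicit Types (U : set space) (X Y : vector_field) (K : tensor11).

Definition basis_vector (i : 'I_N) : 'cV[R]_N := delta_mx i 0.
Definition basis_covector (i : 'I_N) : 'rV[R]_N := delta_mx 0 i.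

Definition tensor_product (u : 'cV[R]_N) (a : 'rV[R]_N) : 'M[R]_N := u *m a.

(* (a /\ b)(X, Y) = a(X) b(Y) - b(X) a(Y) *)
Definition wedge (a b : 'rV[R]_N) : 'M[R]_N := a^T *m b - b^T *m a.

Definition partial {W : normedModType R} (i : 'I_N) (f : space -> W) :
    space -> W :=
  fun x => 'D_(basis_vector i) f x.

Definition exterior_derivative (h : space -> R) : one_form :=
  fun x => \row_i partial i h x.

Definition closed_one_form U (a : one_form) : Prop :=
  smooth_on U a /\
  forall i j x, U x ->
    partial i (fun y => a y 0 j) x = partial j (fun y => a y 0 i) x.

Definition apply11 K X : vector_field := fun x => K x *m X x.

(* K^T a is the 1-form X |-> a (K X). *)
Definition transpose_apply K (a : one_form) : one_form := fun x => a x *m K x.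

Definition lie_bracket X Y : vector_field :=
  fun x => 'D_(X x) Y x - 'D_(Y x) X x.

Definition nijenhuis_torsion K X Y : vector_field := fun x =>
  K x *m (K x *m lie_bracket X Y x)
  + lie_bracket (apply11 K X) (apply11 K Y) x
  - K x *m (lie_bracket X (apply11 K Y) x + lie_bracket (apply11 K X) Y x).

Definition haantjes_torsion K X Y : vector_field := fun x =>
  K x *m (K x *m nijenhuis_torsion K X Y x)
  + nijenhuis_torsion K (apply11 K X) (apply11 K Y) x
  - K x *m (nijenhuis_torsion K X (apply11 K Y) x
            + nijenhuis_torsion K (apply11 K X) Y x).

Definition haantjes_operator U K : Prop :=
  smooth_on U K /\
  forall X Y, smooth_on U X -> smooth_on U Y ->
    forall x, U x -> haantjes_torsion K X Y x = 0.

Definition semisimple U K : Prop := forall x, U x -> diagonalizable (K x).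

Definition module_basis U (A : set tensor11) m (K : 'I_m -> tensor11) : Prop :=
  [/\ forall j, A (K j),
      forall T, A T -> exists c : 'I_m -> space -> R,
        (forall j, smooth_on U (c j)) /\
        (forall x, U x -> T x = \sum_j c j x *: K j x)
    & forall c : 'I_m -> space -> R, (forall j, smooth_on U (c j)) ->
        (forall x, U x -> \sum_j c j x *: K j x = 0) ->
        forall j x, U x -> c j x = 0].

(* The third clause makes membership in A a property of the
   restriction to U. *)
Definition haantjes_algebra U (A : set tensor11) (m : nat) : Prop :=
  [/\ A !=set0,
      forall K, A K -> haantjes_operator U K,
      forall K K' : tensor11, A K -> (forall x, U x -> K x = K' x) -> A K',
      forall (K1 K2 : tensor11) (f g : space -> R), A K1 -> A K2 ->
        smooth_on U f -> smooth_on U g ->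
        A (fun x => f x *: K1 x + g x *: K2 x)
    & forall K1 K2 : tensor11, A K1 -> A K2 -> A (fun x => K1 x *m K2 x)] /\
  exists K : 'I_m -> tensor11, module_basis U A K.

Definition abelian_algebra U (A : set tensor11) : Prop :=
  forall K1 K2 : tensor11, A K1 -> A K2 ->
    forall x, U x -> K1 x *m K2 x = K2 x *m K1 x.

Definition eval02 (w : tensor02) X Y : space -> R :=
  fun x => ((X x)^T *m w x *m Y x) 0 0.

(* The last clause is dw = 0 evaluated on coordinate vector fields. *)
Definition symplectic_manifold U (w : tensor02) : Prop :=
  [/\ open U,
      smooth_on U w,
      forall x, U x -> (w x)^T = - w x,
      forall x, U x -> w x \in unitmx
    & forall i j k x, U x ->
        partial i (fun y => w y j k) x + partial j (fun y => w y k i) x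
        + partial k (fun y => w y i j) x = 0].

Definition omega_haantjes_manifold U (w : tensor02) (A : set tensor11)
    (m : nat) : Prop :=
  [/\ symplectic_manifold U w,
      haantjes_algebra U A m,
      abelian_algebra U A
    & forall K, A K -> forall X Y, smooth_on U X -> smooth_on U Y ->
        forall x, U x -> eval02 w X (apply11 K Y) x = eval02 w (apply11 K X) Y x].

Definition independent_one_forms U m (a : 'I_m -> one_form) : Prop :=
  forall x, U x -> row_free (\matrix_(j < m) a j x).

Definition generates_haantjes_chain U (A : set tensor11) m
    (K : 'I_m -> tensor11) (h : space -> R) : Prop :=
  [/\ smooth_on U h,
      module_basis U A K,
      forall j, closed_one_form U (transpose_apply (K j) (exterior_derivative h))
    & independent_one_forms U
        (fun j => transpose_apply (K j) (exterior_derivative h))].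

Definition potential_functions U m (K : 'I_m -> tensor11) (h : space -> R)
    (Hs : 'I_m -> space -> R) : Prop :=
  forall j, smooth_on U (Hs j) /\
    forall x, U x ->
      exterior_derivative (Hs j) x
      = transpose_apply (K j) (exterior_derivative h) x.

End Fields.

Arguments vector_field : clear implicits.
Arguments one_form : clear implicits.
Arguments tensor11 : clear implicits.
Arguments tensor02 : clear implicits.

Section StackelLift.
Context {R : realType} {n : nat}.

(* Canonical coordinates (q^1, ..., q^{n+1}, p_1, ..., p_{n+1}); the pair
   (q^r, p_r) has index r - 1 in 'I_n.+1, so ord_max stands for n+1. *)
Local Notation phase := 'cV[R]_(n.+1 + n.+1).
Implicit Types (S : 'I_n -> 'I_n -> R -> R) (a : 'I_n -> R -> R -> R).
Implicit Types (b : R -> R) (f : 'I_n.+1 -> R -> R -> R).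

Definition qidx (r : 'I_n.+1) : 'I_(n.+1 + n.+1) := lshift n.+1 r.
Definition pidx (r : 'I_n.+1) : 'I_(n.+1 + n.+1) := rshift n.+1 r.
Definition qcoord (x : phase) (r : 'I_n.+1) : R := x (qidx r) 0.
Definition pcoord (x : phase) (r : 'I_n.+1) : R := x (pidx r) 0.

(* T*(Q x R), for Q identified with the open set V of R^n by its chart. *)
Definition lifted_phase_space (V : set 'cV[R]_n) : set phase :=
  [set x | V (\col_(i < n) qcoord x (lift ord_max i))].

Definition qrange (V : set 'cV[R]_n) (r : 'I_n.+1) : set R :=
  (fun x => qcoord x r) @` lifted_phase_space V.

Definition canonical_form : tensor02 R (n.+1 + n.+1) := fun _ =>
  \sum_(i < n.+1) wedge (basis_covector (pidx i)) (basis_covector (qidx i)).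

Definition stackel_matrix S (v : 'cV[R]_n) :
    'M[R]_n :=
  \matrix_(i, k) S i k (v i 0).

(* a i is S_{i,n+1} and b is S_{n+1,n+1}; unlift ord_max r = None exactly when
   r is the last index, and is Some of the corresponding i < n otherwise. *)
Definition lifted_matrix S a b (x : phase) : 'M[R]_n.+1 :=
  \matrix_(r, j)
    match unlift ord_max r, unlift ord_max j with
    | Some i, Some k => S i k (qcoord x r)
    | Some i, None => a i (qcoord x r) (pcoord x r)
    | None, Some _ => 0
    | None, None => b (qcoord x r)
    end.

Definition lifted_hamiltonian S a b f (j : 'I_n.+1) (x : phase) : R :=
  (invmx (lifted_matrix S a b x)
     *m \col_r f r (qcoord x r) (pcoord x r)) j 0.

(* Indices are swapped as in the adjugate: this is the cofactor of the entry in
   row r, column j. *)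
Definition lifted_cofactor S a b (j r : 'I_n.+1) (x : phase) : R :=
  cofactor (lifted_matrix S a b x) r j.

Definition lifted_domain (V : set 'cV[R]_n) S a b f : set phase :=
  [set x | [/\ lifted_phase_space V x,
      forall r, lifted_cofactor S a b ord0 r x != 0
    & forall r, partial (pidx r) (lifted_hamiltonian S a b f ord0) x != 0]].

Definition lifted_mu S a b (j r : 'I_n.+1) (x : phase) : R :=
  lifted_cofactor S a b j r x / lifted_cofactor S a b ord0 r x.

Definition lifted_operator S a b (j : 'I_n.+1) : tensor11 R (n.+1 + n.+1) :=
  fun x => \sum_(r < n.+1) lifted_mu S a b j r x *:
    (tensor_product (basis_vector (qidx r)) (basis_covector (qidx r))
     + tensor_product (basis_vector (pidx r)) (basis_covector (pidx r))).

End StackelLift.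

(* Main.v *)
Require Import Defs.
From HB Require Import structures.
From mathcomp Require Import all_boot all_order all_algebra.
From mathcomp Require Import all_classical all_reals all_analysis.
From mathcomp Require Import ring.

(** Every operator that is diagonal in the coordinates has vanishing Haantjes
    torsion, whatever its eigenvalues, so the fields diagonal in (q, p) whose
    eigenvalues on q^r and p_r agree form an Abelian Haantjes algebra compatible
    with the canonical form.  The K_j are a basis of it because the matrix of
    the mu_jr is the adjugate of L with its r-th column divided by the cofactor
    L~_1r.  Row s of L H = F depends only on (q^s, p_s); differentiating along
    q^r or p_r shows that L dH is supported on row r, so the derivatives of the
    H_j are proportional to the cofactors of that row, i.e. dH_j = K_j^T dH_1. *)

Set Implicit Arguments.
Unset Strict Implicit.
Unset Printing Implicit Defensive.

Import Order.TTheory GRing.Theory Num.Theory.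
Import numFieldNormedType.Exports.

Local Open Scope classical_set_scope.
Local Open Scope ring_scope.

(** * Calculus of smooth functions *)

Section SmoothCalculus.
Context {R : realType} {V : normedModType R}.

(** The difference [g - f] vanishes near [x], so the zero map satisfies the expansion defining its
    differential; uniqueness of the differential then gives differentiability, and [g] is [f] plus
    this difference. *)
Lemma near_eq_differentiable (W : normedModType R) (f g : V -> W) (x : V) :
  (\near x, f x = g x) -> differentiable f x -> differentiable g x.
Proof.
move=> fg df; suff dh : differentiable (g - f) x.
  have -> : g = f + (g - f) by rewrite addrC subrK.
  exact: differentiableD.
have h0 : (g - f) \o shift x
    = cst ((g - f) x) + (\0 : {linear V -> W}) +o_ 0 id.
  apply/eqaddoP => _/posnumP[e].
  have := fg; rewrite (near_shift 0) => fg0.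
  have fgx : f x = g x := nbhs_singleton fg.
  near=> h.
  have fgh : f (h + x) = g (h + x) by near: h; rewrite subr0 in fg0; exact: fg0.
  have -> : ((g - f) \o shift x - (cst ((g - f) x) + \0)) h
      = (g (h + x) - f (h + x)) - ((g x - f x) + 0) by [].
  by rewrite fgh fgx !subrr addr0 subr0 normr0 mulr_ge0.
apply/diff_locallyP.
have c0 : continuous (\0 : {linear V -> W}) by exact: cst_continuous.
by have -> := diff_unique c0 h0.
Unshelve. all: by end_near. Qed.

(** Openness of [U] turns equality on [U] into equality near each of its points, which derivatives
    respect. The inductions below use this to replace a derivative by a formula valid only on
    [U]. *)
Lemma Ck_eq (W : normedModType R) k (U : set V) (f g : V -> W) :
  open U -> (forall x, U x -> f x = g x) -> Ck k U f -> Ck k U g.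
Proof.
move=> oU; have nU P x : (forall y, U y -> P y) -> U x -> \near x, P x.
  by move=> UP Ux; apply: filterS (open_nbhs_nbhs (conj oU Ux)).
elim: k f g => [|k IH] f g fg /=.
  move=> cf x Ux; change (g @ x --> g x); rewrite -(fg x Ux).
  by apply: cvg_trans (cf x Ux); apply: near_eq_cvg; apply: nU Ux.
move=> [df ddf]; split=> [x Ux|v].
  by apply: near_eq_differentiable (df x Ux); apply: nU Ux.
apply: IH (ddf v) => x Ux.
by apply: near_eq_derive; apply: nU Ux.
Qed.

Lemma CkW (W : normedModType R) k (U : set V) (f : V -> W) :
  Ck k.+1 U f -> Ck k U f.
Proof.
elim: k f => [|k IH] f.
  by move=> [df _] x Ux; apply: differentiable_continuous; exact: df.
by move=> [df ddf]; split=> // v; apply: IH; exact: ddf.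
Qed.

Lemma Ck_cst (W : normedModType R) k (U : set V) (c : W) : Ck k U (cst c).
Proof.
elim: k c => [|k IH] c /=; first by move=> x _; exact: cst_continuous.
split=> [x _|v]; first exact: differentiable_cst.
rewrite (_ : (fun x => _) = cst 0) //.
by apply/funext => x; rewrite derive_cst.
Qed.

(** By the chain rule the derivative of [f \o l] along [v] is the derivative of [f] along the fixed
    vector [l v], composed with [l]: the shape is preserved, so the induction closes. *)
Lemma Ck_comp_linear (V' W : normedModType R) k (U : set V) (U' : set V')
    (l : {linear V -> V'}) (f : V' -> W) :
  open U -> continuous l -> (forall x, U x -> U' (l x)) ->
  Ck k U' f -> Ck k U (f \o l).
Proof.
move=> oU cl UU'; elim: k f => [|k IH] f /=.
  move=> cf x Ux; apply: continuous_comp; first exact: cl.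
  by apply: cf; exact: UU'.
have dl x : differentiable l x by exact: linear_differentiable.
move=> [df ddf]; split=> [x Ux|v].
  by apply: differentiable_comp; [exact: dl|exact: df (UU' _ Ux)].
apply: Ck_eq (IH _ (ddf (l v))) => // x Ux.
have dfx := df _ (UU' _ Ux).
rewrite /= (deriveE _ dfx) (deriveE _ (differentiable_comp (dl x) dfx)).
by rewrite (diff_comp (dl x) dfx)/= diff_lin.
Qed.

Lemma Ck_linear (W : normedModType R) k (U : set V) (l : {linear V -> W}) :
  open U -> continuous l -> Ck k U l.
Proof.
move=> oU cl; case: k => [|k]; first by move=> x _; exact: cl.
split=> [x _|v]; first exact: linear_differentiable.
apply: Ck_eq (Ck_cst k U (l v)) => // x Ux.
by rewrite deriveE ?diff_lin//; exact: linear_differentiable.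
Qed.

Lemma CkD (W : normedModType R) k (U : set V) (f g : V -> W) :
  open U -> Ck k U f -> Ck k U g -> Ck k U (f + g).
Proof.
move=> oU; elim: k f g => [|k IH] f g /=.
  by move=> cf cg x Ux; apply: continuousD; [exact: cf|exact: cg].
move=> [df ddf] [dg ddg]; split=> [x Ux|v].
  by apply: differentiableD; [exact: df|exact: dg].
apply: Ck_eq (IH _ _ (ddf v) (ddg v)) => // x Ux.
by rewrite deriveD//; apply: diff_derivable; [exact: df|exact: dg].
Qed.

Lemma CkM k (U : set V) (f g : V -> R) :
  open U -> Ck k U f -> Ck k U g -> Ck k U (f * g).
Proof.
move=> oU; elim: k f g => [|k IH] f g.
  by move=> cf cg x Ux; apply: continuousM; [exact: cf|exact: cg].
(* The Leibniz rule keeps one factor undifferentiated, so [f] and [g] themselves are also needed at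
   order [k]. *)
move=> Cf Cg; have [Cf' Cg'] := (CkW Cf, CkW Cg).
case: Cf Cg => [df ddf] [dg ddg]; split=> [x Ux|v].
  by apply: differentiableM; [exact: df|exact: dg].
apply: Ck_eq (CkD oU (IH _ _ Cf' (ddg v)) (IH _ _ Cg' (ddf v))) => // x Ux.
by rewrite deriveM//; apply: diff_derivable; [exact: df|exact: dg].
Qed.

(** The derivative of [1/f] is [- f^-2] times that of [f]; it involves [1/f] only at order [k],
    where the induction hypothesis applies. *)
Lemma CkV k (U : set V) (f : V -> R) :
  open U -> (forall x, U x -> f x != 0) -> Ck k U f ->
  Ck k U (fun x => (f x)^-1).
Proof.
move=> oU f0; elim: k => [|k IH].
  by move=> cf x Ux; apply: continuousV; [exact: f0|exact: cf].
move=> Cf; have Cf' := CkW Cf; case: Cf => [df ddf]; split=> [x Ux|v].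
  by apply: differentiableV; [exact: df|exact: f0].
have CV := IH Cf'.
have := CkM oU (CkM oU (CkM oU CV CV) (@Ck_cst R k U (- 1 : R))) (ddf v).
apply: Ck_eq => // x Ux.
rewrite deriveV; last by apply: diff_derivable; exact: df.
  by rewrite !fctE /= mulrN1 -invrM ?unitfE ?f0// -expr2.
exact: f0.
Qed.

Lemma Ck_scalel (W : normedModType R) k (U : set V) (f : V -> R) (w : W) :
  open U -> Ck k U f -> Ck k U (fun x => f x *: w).
Proof.
move=> oU; elim: k f => [|k IH] f.
  by move=> cf x Ux; apply: cvgZr_tmp; exact: cf.
move=> [df ddf]; split=> [x Ux|v].
  by apply: differentiableZl; exact: df.
apply: Ck_eq (IH _ (ddf v)) => // x Ux.
have dfx := df _ Ux.
rewrite (deriveE _ dfx) (deriveE _ (differentiableZl w dfx)).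
by rewrite (diffZl w dfx).
Qed.

Variable U : set V.
Hypothesis oU : open U.

Lemma smooth_eq (W : normedModType R) (f g : V -> W) :
  (forall x, U x -> f x = g x) -> smooth_on U f -> smooth_on U g.
Proof. by move=> fg sf k; exact: Ck_eq (sf k). Qed.

Lemma smooth_differentiable (W : normedModType R) (f : V -> W) x :
  smooth_on U f -> U x -> differentiable f x.
Proof. by move=> /(_ 1%N)[df _]; exact: df. Qed.

Lemma smooth_continuous (W : normedModType R) (f : V -> W) x :
  smooth_on U f -> U x -> {for x, continuous f}.
Proof. by move=> /(_ 0%N); exact. Qed.

Lemma smooth_derive (W : normedModType R) (f : V -> W) v :
  smooth_on U f -> smooth_on U (fun x => 'D_v f x).
Proof. by move=> sf k; have [_] := sf k.+1; exact. Qed.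

Lemma smooth_cst (W : normedModType R) (c : W) : smooth_on U (fun=> c).
Proof. by move=> k; exact: Ck_cst. Qed.

Lemma smoothM (f g : V -> R) :
  smooth_on U f -> smooth_on U g -> smooth_on U (fun x => f x * g x).
Proof. by move=> sf sg k; exact: CkM. Qed.

Lemma smoothV (f : V -> R) : (forall x, U x -> f x != 0) ->
  smooth_on U f -> smooth_on U (fun x => (f x)^-1).
Proof. by move=> f0 sf k; exact: CkV. Qed.

Lemma smoothD (W : normedModType R) (f g : V -> W) :
  smooth_on U f -> smooth_on U g -> smooth_on U (fun x => f x + g x).
Proof. by move=> sf sg k; exact: CkD. Qed.

Lemma smooth_sum (W : normedModType R) (I : Type) (r : seq I) (P : pred I)
    (F : I -> V -> W) :
  (forall i, smooth_on U (F i)) ->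
  smooth_on U (fun x => \sum_(i <- r | P i) F i x).
Proof.
move=> sF; elim: r => [|i r IH].
  by rewrite (_ : (fun x => _) = fun=> 0); [exact: smooth_cst|
    apply/funext => x; rewrite big_nil].
case Pi: (P i); rewrite (_ : (fun x => _) =
    if P i then fun x => F i x + \sum_(i <- r | P i) F i x
    else fun x => \sum_(i <- r | P i) F i x);
  by [rewrite Pi//; apply: smoothD|apply/funext => x; rewrite big_cons Pi].
Qed.

Lemma smooth_prod (I : Type) (r : seq I) (P : pred I) (F : I -> V -> R) :
  (forall i, smooth_on U (F i)) ->
  smooth_on U (fun x => \prod_(i <- r | P i) F i x).
Proof.
move=> sF; elim: r => [|i r IH].
  by rewrite (_ : (fun x => _) = fun=> 1); [exact: smooth_cst|
    apply/funext => x; rewrite big_nil].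
case Pi: (P i); rewrite (_ : (fun x => _) =
    if P i then fun x => F i x * \prod_(i <- r | P i) F i x
    else fun x => \prod_(i <- r | P i) F i x);
  by [rewrite Pi//; apply: smoothM|apply/funext => x; rewrite big_cons Pi].
Qed.

Lemma smooth_comp_linear (V' W : normedModType R) (U' : set V')
    (l : {linear V -> V'}) (f : V' -> W) :
  continuous l -> (forall x, U x -> U' (l x)) ->
  smooth_on U' f -> smooth_on U (fun x => f (l x)).
Proof. by move=> cl UU' sf k; exact: Ck_comp_linear (sf k). Qed.

Lemma smooth_linear (W : normedModType R) (l : {linear V -> W}) :
  continuous l -> smooth_on U l.
Proof. by move=> cl k; exact: Ck_linear. Qed.

Lemma smooth_mx m n (M : V -> 'M[R]_(m, n)) :
  (forall i j, smooth_on U (fun x => M x i j)) -> smooth_on U M.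
Proof.
move=> sM.
apply: (@smooth_eq _ (fun x => \sum_i \sum_j M x i j *: delta_mx i j)).
  by move=> x _; rewrite -matrix_sum_delta.
apply: smooth_sum => i; apply: smooth_sum => j k.
by apply: Ck_scalel => //; exact: sM.
Qed.

Lemma smooth_det m (M : V -> 'M[R]_m) :
  (forall i j, smooth_on U (fun x => M x i j)) ->
  smooth_on U (fun x => \det (M x)).
Proof.
move=> sM; apply: smooth_sum => s.
by apply: smoothM; [exact: smooth_cst|exact: smooth_prod].
Qed.

Lemma smooth_cofactor m (M : V -> 'M[R]_m) i j :
  (forall i j, smooth_on U (fun x => M x i j)) ->
  smooth_on U (fun x => cofactor (M x) i j).
Proof.
move=> sM; apply: smoothM; first exact: smooth_cst.
apply: smooth_det => k l.
by rewrite (_ : (fun x => _) = fun x => M x (lift i k) (lift j l));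
  [exact: sM | apply/funext => x; rewrite !mxE].
Qed.

End SmoothCalculus.

(** * Matrix entries, restriction to subsets and substitution of coordinates *)

Lemma coord_linear_continuous (R : realType) m n i j :
  exists2 l : {linear 'M[R]_(m, n) -> R},
    continuous l & forall M, l M = M i j.
Proof.
have l_lin : linear (fun M : 'M[R]_(m, n) => M i j) by move=> a A B; rewrite !mxE.
pose lM := GRing.isLinear.Build _ _ _ _ _ l_lin.
pose l : {linear 'M[R]_(m, n) -> R} := HB.pack (fun M : 'M[R]_(m, n) => M i j) lM.
by exists l; first exact: coord_continuous.
Qed.

(** Here the linear map is applied after the function, and differentiation commutes with it. *)
Lemma smooth_coord (R : realType) (V : normedModType R) (U : set V)
    m n (M : V -> 'M[R]_(m, n)) i j :
  open U -> smooth_on U M -> smooth_on U (fun x => M x i j).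
Proof.
move=> oU; have dC k (f : V -> 'M[R]_(m, n)) :
    Ck k U f -> Ck k U (fun x => f x i j).
  have [l cl lE] := coord_linear_continuous R i j.
  have dl y : differentiable l y by exact: linear_differentiable.
  rewrite (_ : (fun x => _) = l \o f); last by apply/funext => x /=; rewrite lE.
  elim: k f => [|k IH] f /=.
    by move=> cf x Ux; apply: continuous_comp; [exact: cf|exact: cl].
  move=> [df ddf]; split=> [x Ux|v].
    by apply: differentiable_comp; [exact: df|exact: dl].
  apply: Ck_eq (IH _ (ddf v)) => // x Ux.
  have dfx := df _ Ux.
  rewrite /= (deriveE _ dfx) (deriveE _ (differentiable_comp dfx (dl _))).
  by rewrite (diff_comp dfx (dl _))/= diff_lin.
by move=> sM k; exact: dC.
Qed.

Lemma Ck_subset (R : realType) (V W : normedModType R) k (U U' : set V)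
    (f : V -> W) : U `<=` U' -> Ck k U' f -> Ck k U f.
Proof.
move=> UU'; elim: k f => [|k IH] f; first by move=> cf x /UU'; exact: cf.
by move=> [df ddf]; split=> [x /UU'|v]; [exact: df|exact: IH (ddf v)].
Qed.

Lemma smooth_subset (R : realType) (V W : normedModType R) (U U' : set V)
  (f : V -> W) : U `<=` U' -> smooth_on U' f -> smooth_on U f.
Proof. by move=> UU' sf k; exact: Ck_subset (sf k). Qed.

(** The finitely many conditions amount to the nonvanishing of one continuous function, the product
    of the [g i]. *)
Lemma open_neq0 (R : realType) (V : normedModType R) (U : set V) (I : finType)
    (g : I -> V -> R) : open U -> (forall i, smooth_on U (g i)) ->
  open [set x | U x /\ forall i, g i x != 0].
Proof.
move=> oU sg; rewrite openE => x [Ux gx].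
have sG : smooth_on U (fun x => \prod_i g i x) by exact: smooth_prod.
have Gx : \prod_i g i x != 0 by apply/prodf_neq0 => i _.
have oN : open [set y : R | y != 0].
  by rewrite (_ : [set y | _] = ~` [set 0]);
    [exact/closed_openC/closed_eq|apply/seteqP; split=> y /= /eqP].
have NG := smooth_continuous sG Ux (open_nbhs_nbhs (conj oN Gx)).
have NU := open_nbhs_nbhs (conj oU Ux).
near=> y; split; first by near: y.
have : \prod_i g i y != 0 by near: y; exact: NG.
by move/prodf_neq0 => h i; exact: h.
Unshelve. all: by end_near. Qed.

Lemma derive_translation_invariant (R : realType) (V W : normedModType R)
    (g : V -> W) (v x : V) :
  (forall h : R, g (h *: v + x) = g x) -> 'D_v g x = 0.
Proof.
move=> gE; rewrite /derive (_ : (fun h => _) = cst 0); first exact: lim_cst.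
by apply/funext => h; rewrite /= gE subrr scaler0.
Qed.

Lemma smooth_comp_coord2 (R : realType) (W : normedModType R) N
    (U : set 'cV[R]_N) (U' : set (R * R)) (f : R * R -> W) i j :
  open U -> (forall x, U x -> U' (x i 0, x j 0)) -> smooth_on U' f ->
  smooth_on U (fun x => f (x i 0, x j 0)).
Proof.
move=> oU UU' sf.
have l_lin : linear (fun x : 'cV[R]_N => (x i 0, x j 0)).
  by move=> a x y; rewrite !mxE.
pose lM := GRing.isLinear.Build _ _ _ _ _ l_lin.
pose l : {linear 'cV[R]_N -> (R * R)%type} :=
  HB.pack (fun x : 'cV[R]_N => (x i 0, x j 0)) lM.
apply: (smooth_comp_linear (l := l) oU _ UU' sf) => x.
change ((fun y : 'cV[R]_N => (y i 0, y j 0)) @ x --> (x i 0, x j 0)).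
have h := cvg_pair (@coord_continuous R N 1 i 0 x) (@coord_continuous R N 1 j 0 x).
exact: h.
Qed.

Lemma smooth_comp_coord (R : realType) (W : normedModType R) N
    (U : set 'cV[R]_N) (U' : set R) (f : R -> W) i :
  open U -> (forall x, U x -> U' (x i 0)) -> smooth_on U' f ->
  smooth_on U (fun x => f (x i 0)).
Proof.
move=> oU UU' sf; have [l cl lE] := coord_linear_continuous R i (0 : 'I_1).
apply: (smooth_eq oU (f := fun x => f (l x))) => [x Ux|]; first by rewrite lE.
by apply: (smooth_comp_linear oU cl _ sf) => x; rewrite lE; exact: UU'.
Qed.

(** * Symmetry of second derivatives *)

Section MixedDerivatives.
Context {R : realType} {V : normedModType R}.

Lemma is_derive_line (f : V -> R) (u w : V) (s : R) :
  differentiable f (s *: u + w) ->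
  is_derive s 1 (fun s => f (s *: u + w)) ('D_u f (s *: u + w)).
Proof.
pose l s : V := s *: u + w.
move=> df; have dl : is_diff s l ( *:%R ^~ u).
  have -> : l = *:%R ^~ u + cst w by [].
  exact: is_diff_eq (is_diffD (is_diff_scalel s u) (is_diff_cst w s)) (addr0 _).
have dfl := differentiable_comp (ex_diff (is_diff_def := dl)) df.
apply: DeriveDef; first exact: diff_derivable.
rewrite (deriveE _ dfl) (diff_comp (ex_diff (is_diff_def := dl)) df) /=.
by rewrite (diff_val (is_diff_def := dl)) scale1r -deriveE.
Qed.

(** The mean value theorem is applied twice: in direction [u] to the difference of [f] along two
    parallel segments, then in direction [v] to the derivative so obtained. *)
Lemma second_difference (U : set V) (f : V -> R) (x u v : V) (t : R) :
  Ck 2 U f -> 0 < t ->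
  (forall a b, 0 <= a <= t -> 0 <= b <= t -> U (a *: u + (b *: v + x))) ->
  exists a b, [/\ 0 <= a <= t, 0 <= b <= t &
    f (t *: u + (t *: v + x)) - f (t *: u + x) - f (t *: v + x) + f x
    = 'D_v (fun y => 'D_u f y) (a *: u + (b *: v + x)) * t ^+ 2].
Proof.
move=> [df ddf] t0 Ut.
have t_ge0 : 0 <= t <= t by rewrite ltW/=.
have z_ge0 : 0 <= (0 : R) <= t by rewrite lexx ltW.
pose g (s : R) := f (s *: u + (t *: v + x)) - f (s *: u + x).
have dg (s : R) : 0 <= s <= t ->
    is_derive s 1 g ('D_u f (s *: u + (t *: v + x)) - 'D_u f (s *: u + x)).
  move=> s0; apply: is_deriveB; apply: is_derive_line; apply: df.
    exact: Ut.
  by have := Ut s 0 s0 z_ge0; rewrite scale0r add0r.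
have in_itv01 (s : R) : s \in `]0, t[ -> 0 <= s <= t.
  by rewrite in_itv/= => /andP[/ltW-> /ltW->].
have in_itvc (s : R) : s \in `[0, t] -> 0 <= s <= t by rewrite in_itv.
have [a /in_itv01 a0] := MVT t0 (fun s h => dg s (in_itv01 s h))
  (derivable_within_continuous
    (fun s h => ex_derive (is_derive := dg s (in_itvc s h)))).
have [du _] := ddf u.
pose h (s : R) := 'D_u f (s *: v + (a *: u + x)).
have dh (s : R) : 0 <= s <= t ->
    is_derive s 1 h ('D_v (fun y => 'D_u f y) (s *: v + (a *: u + x))).
  move=> s0; apply: is_derive_line; apply: du.
  by rewrite addrCA; exact: Ut.
have [b /in_itv01 b0] := MVT t0 (fun s k => dh s (in_itv01 s k))
  (derivable_within_continuous
    (fun s k => ex_derive (is_derive := dh s (in_itvc s k)))).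
rewrite /h /g !subr0 !scale0r !add0r !(addrCA _ (a *: u)) => hE gE.
exists a, b; split => //.
by rewrite expr2 mulrA -hE -gE; ring.
Qed.

(** As [t] tends to 0, both evaluation points, which may differ, tend to [x]; continuity of [A] and
    [B] finishes with an [e / 2] argument. *)
Lemma eq_at_limit (U : set V) (A B : V -> R) (x u v : V) :
  open U -> U x -> {for x, continuous A} -> {for x, continuous B} ->
  (forall t, 0 < t ->
    (forall a b, 0 <= a <= t -> 0 <= b <= t -> U (a *: u + (b *: v + x))) ->
    exists a b c d, [/\ 0 <= a <= t, 0 <= b <= t, 0 <= c <= t, 0 <= d <= t &
      A (a *: u + (b *: v + x)) = B (c *: u + (d *: v + x))]) ->
  A x = B x.
Proof.
move=> oU Ux cA cB AB; apply/eqP; rewrite -subr_eq0 -normr_le0.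
apply/ler_addgt0Pl => e e0; rewrite addr0.
have e20 : 0 < e / 2 by rewrite divr_gt0.
have /cvgrPdist_lt /(_ _ e20) NA := cA.
have /cvgrPdist_lt /(_ _ e20) NB := cB.
have NU : \near x, U x by apply: open_nbhs_nbhs.
have lc : (fun z : R * R => z.1 *: u + (z.2 *: v + x)) @ ((0, 0) : R * R) --> x.
  have {2}-> : x = 0 *: u + (0 *: v + x) by rewrite !scale0r !add0r.
  apply: cvgD; first by apply: cvgZr_tmp; exact: cvg_fst.
  apply: cvgD; last exact: cvg_cst.
  by apply: cvgZr_tmp; exact: cvg_snd.
have NQ : nbhs x (fun y => U y /\ `|A x - A y| < e / 2 /\ `|B x - B y| < e / 2).
  by apply: filterI => //; apply: filterI.
have [[I J] /= [/nbhs_ballP[r1 /= r10 I1] /nbhs_ballP[r2 /= r20 J2]] IJ] :=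
  lc _ NQ.
(* Halving the smaller radius places the whole closed interval from 0 to [t] inside both open
   balls. *)
pose t := Num.min r1 r2 / 2.
have t0 : 0 < t by rewrite divr_gt0// lt_min r10.
have tr a : 0 <= a <= t -> I a /\ J a.
  move=> /andP[a0 at_]; have : a < Num.min r1 r2.
    by rewrite (le_lt_trans at_)// ltr_pdivrMr// ltr_pMr ?ltr1n// lt_min r10.
  rewrite lt_min => /andP[a1 a2].
  by split; [apply: I1|apply: J2]; rewrite /ball/= sub0r normrN ger0_norm.
have P a b (ha : 0 <= a <= t) (hb : 0 <= b <= t) :=
  IJ (a, b) (conj (tr a ha).1 (tr b hb).2).
have [a [b [c [d [a0 b0 c0 d0 E]]]]] := AB t t0 (fun a b ha hb => (P a b ha hb).1).
have [_ [h1 _]] := P a b a0 b0; have [_ [_ h2]] := P c d c0 d0.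
rewrite -(subrKA (A (a *: u + (b *: v + x)))).
rewrite [leRHS](splitr e) (le_trans (ler_normD _ _))// lerD ?(ltW h1)//.
by rewrite E distrC ltW.
Qed.

(** Schwarz's theorem: the second difference of [f] is symmetric in [u] and [v], so the two mixed
    derivatives agree at some points of every small parallelogram at [x]. *)
Lemma derive_sym (U : set V) (f : V -> R) (x u v : V) :
  open U -> Ck 2 U f -> U x ->
  'D_v (fun y => 'D_u f y) x = 'D_u (fun y => 'D_v f y) x.
Proof.
move=> oU sf Ux.
have [_ ddf] := sf; have [_ cuv] := ddf u; have [_ cvu] := ddf v.
apply: (eq_at_limit (u := u) (v := v) oU Ux (cuv v x Ux) (cvu u x Ux)).
move=> t t0 Ut; have t20 : t ^+ 2 != 0 by rewrite expf_neq0// gt_eqF.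
have [a [b [a0 b0 ab]]] := second_difference sf t0 Ut.
have Ut' c d : 0 <= c <= t -> 0 <= d <= t -> U (c *: v + (d *: u + x)).
  by move=> hc hd; rewrite addrCA; exact: Ut.
(* With [u] and [v] exchanged, the first parameter found is the coefficient of [v], hence the order
   [d], [c]. *)
have [d [c [d0 c0 cd]]] := second_difference sf t0 Ut'.
have E : f (t *: v + (t *: u + x)) - f (t *: v + x) - f (t *: u + x) + f x
    = f (t *: u + (t *: v + x)) - f (t *: u + x) - f (t *: v + x) + f x.
  by rewrite (addrCA (t *: v)); congr (_ + _); rewrite addrAC.
exists a, b, c, d; split; [exact: a0|exact: b0|exact: c0|exact: d0|].
apply: (mulIf t20); apply: (etrans (esym ab)); apply: (etrans (esym E)).
apply: (etrans cd).
exact: (congr1 (fun y => 'D_u (fun y => 'D_v f y) y * t ^+ 2) (addrCA _ _ _)).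
Qed.

End MixedDerivatives.

(** * Diagonal tensor fields *)

(** Both torsions of a diagonal field have this shape, so each of their components reduces to a
    scalar expression in four known entries. *)
Lemma diagonal_combination (R : comPzRingType) n (d : 'rV[R]_n)
    (A B C D : 'cV[R]_n) i (a b c e : R) :
  A i 0 = a -> B i 0 = b -> C i 0 = c -> D i 0 = e ->
  (diag_mx d *m (diag_mx d *m A) + B - diag_mx d *m (C + D)) i 0
  = d 0 i * (d 0 i * a) + b - d 0 i * (c + e).
Proof. by move=> <- <- <- <-; rewrite !mul_diag_mx !mxE. Qed.

Section DiagonalTensors.
Context {R : realType} {N : nat}.
Variables (U : set 'cV[R]_N) (K : tensor11 R N) (k : 'cV[R]_N -> 'rV[R]_N).
Hypothesis oU : open U.
Hypothesis KE : forall x, U x -> K x = diag_mx (k x).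
Hypothesis k_smooth : forall i, smooth_on U (fun x => k x 0 i).

Lemma smooth_diagonal : smooth_on U K.
Proof.
apply: (smooth_eq oU (f := fun x => diag_mx (k x))) => [x Ux|].
  by rewrite KE.
apply: smooth_mx => // i j.
rewrite (_ : (fun x => _) = fun x => k x 0 i * (i == j)%:R).
  by apply: smoothM => //; exact: smooth_cst.
by apply/funext => x; rewrite mxE mulr_natr.
Qed.

Lemma apply_diagonal (X : vector_field R N) x i :
  U x -> apply11 K X x i 0 = k x 0 i * X x i 0.
Proof. by move=> Ux; rewrite /apply11 KE// mul_diag_mx mxE. Qed.

Lemma smooth_apply_diagonal (X : vector_field R N) :
  smooth_on U X -> smooth_on U (apply11 K X).
Proof.
move=> sX; apply: smooth_mx => // i j.
apply: (smooth_eq oU (f := fun x => k x 0 i * X x i 0)) => [x Ux|].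
  by rewrite ord1 apply_diagonal.
by apply: smoothM => //; exact: smooth_coord.
Qed.

Lemma derive_field_coord (X : vector_field R N) x v i :
  smooth_on U X -> U x -> ('D_v X x) i 0 = 'D_v (fun y => X y i 0) x.
Proof.
move=> sX Ux; rewrite derive_mx ?mxE//.
exact/diff_derivable/(smooth_differentiable sX Ux).
Qed.

Lemma derive_apply_diagonal (X : vector_field R N) x v i :
  smooth_on U X -> U x ->
  'D_v (fun y => apply11 K X y i 0) x
  = k x 0 i * 'D_v (fun y => X y i 0) x + X x i 0 * 'D_v (fun y => k y 0 i) x.
Proof.
move=> sX Ux.
rewrite (near_eq_derive (g := (fun y => k y 0 i) * (fun y => X y i 0))).
  rewrite deriveM//; apply/diff_derivable.
    exact: smooth_differentiable (k_smooth i) Ux.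
  exact: smooth_differentiable (smooth_coord _ _ oU sX) Ux.
apply: filterS (open_nbhs_nbhs (conj oU Ux)) => y Uy.
by rewrite apply_diagonal.
Qed.

(** Taking the directional derivatives as parameters [dX] and [dY] lets one formula serve the four
    brackets of the Nijenhuis torsion, with the Leibniz rule already applied. *)
Lemma lie_bracket_coord (X Y : vector_field R N) x i (dX dY : 'cV[R]_N -> R) :
  smooth_on U X -> smooth_on U Y -> U x ->
  (forall v, 'D_v (fun y => X y i 0) x = dX v) ->
  (forall v, 'D_v (fun y => Y y i 0) x = dY v) ->
  lie_bracket X Y x i 0 = dY (X x) - dX (Y x).
Proof.
move=> sX sY Ux dXE dYE; rewrite -dXE -dYE -(derive_field_coord _ _ sX Ux).
by rewrite -(derive_field_coord _ _ sY Ux) /lie_bracket !mxE.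
Qed.

(** In component [i] the terms that differentiate [X] or [Y] cancel, and only derivatives of the
    [i]-th eigenvalue survive. *)
Lemma nijenhuis_diagonal (X Y : vector_field R N) x i :
  smooth_on U X -> smooth_on U Y -> U x ->
  let dk v := 'D_v (fun y => k y 0 i) x in
  nijenhuis_torsion K X Y x i 0
  = (dk (apply11 K X x) - k x 0 i * dk (X x)) * Y x i 0
    - (dk (apply11 K Y x) - k x 0 i * dk (Y x)) * X x i 0.
Proof.
move=> sX sY Ux dk.
have sKX := smooth_apply_diagonal sX; have sKY := smooth_apply_diagonal sY.
rewrite /nijenhuis_torsion (KE Ux).
have dKX v := derive_apply_diagonal v i sX Ux.
have dKY v := derive_apply_diagonal v i sY Ux.
(* The derivatives of the components become opaque functions, so that [ring] sees them as atoms. *)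
have [dX dXE] : exists dX, forall v, 'D_v (fun y => X y i 0) x = dX v.
  by exists (fun v => 'D_v (fun y => X y i 0) x).
have [dY dYE] : exists dY, forall v, 'D_v (fun y => Y y i 0) x = dY v.
  by exists (fun v => 'D_v (fun y => Y y i 0) x).
have {}dKX v : 'D_v (fun y => apply11 K X y i 0) x
    = k x 0 i * dX v + X x i 0 * dk v by rewrite dKX dXE.
have {}dKY v : 'D_v (fun y => apply11 K Y y i 0) x
    = k x 0 i * dY v + Y x i 0 * dk v by rewrite dKY dYE.
rewrite [LHS](diagonal_combination _
  (lie_bracket_coord sX sY Ux dXE dYE) (lie_bracket_coord sKX sKY Ux dKX dKY)
  (lie_bracket_coord sX sKY Ux dXE dKY) (lie_bracket_coord sKX sY Ux dKX dYE)).
move: dk {dKX dKY} => dk; ring.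
Qed.

(** Component [i] of the Nijenhuis torsion is [alpha X * Y_i - alpha Y * X_i]. Replacing [X] or [Y]
    by its image under [K] multiplies the bare component by the eigenvalue, and the four Haantjes
    terms cancel in pairs for any [alpha]. *)
Lemma haantjes_diagonal : haantjes_operator U K.
Proof.
split=> [|X Y sX sY x Ux]; first exact: smooth_diagonal.
have sKX := smooth_apply_diagonal sX; have sKY := smooth_apply_diagonal sY.
apply/matrixP => i j; rewrite ord1 /haantjes_torsion (KE Ux).
rewrite [LHS](diagonal_combination _
  (nijenhuis_diagonal i sX sY Ux) (nijenhuis_diagonal i sKX sKY Ux)
  (nijenhuis_diagonal i sX sKY Ux) (nijenhuis_diagonal i sKX sY Ux)).
rewrite !(apply_diagonal _ _ Ux) [RHS]mxE.
move: (derive (fun y => k y 0 i) x) => dk; ring.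
Qed.

End DiagonalTensors.

(** * Cofactor identities *)

(** The minor omits row [r] and keeps the scaling of all other rows. The resulting factor does not
    depend on [j], so it cancels in quotients of cofactors of one row. *)
Lemma cofactor_diag_mul (R : comNzRingType) m (d : 'rV[R]_m.+1) (A : 'M[R]_m.+1)
    r j :
  cofactor (diag_mx d *m A) r j
  = (\prod_k d 0 (lift r k)) * cofactor A r j.
Proof.
rewrite /cofactor mulrCA; congr (_ * _).
rewrite (_ : row' r (col' j (diag_mx d *m A))
  = diag_mx (\row_k d 0 (lift r k)) *m row' r (col' j A)).
  by rewrite det_mulmx det_diag; under eq_bigr do rewrite mxE.
by apply/matrixP => s t; rewrite !mul_diag_mx !mxE.
Qed.

Lemma mul_adj_entry (R : comNzRingType) m (A : 'M[R]_m) s r :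
  \sum_j A s j * cofactor A r j = (\det A) *+ (s == r).
Proof.
have := mul_mx_adj A => /matrixP/(_ s r); rewrite !mxE => <-.
by apply: eq_bigr => j _; rewrite mxE.
Qed.

(** * Operators with equal eigenvalues on [q^r] and [p_r] *)

Section PairedDiagonal.
Context {R : realType} {n : nat}.
Implicit Types g : 'rV[R]_n.+1.

Definition paired_diag g : 'M[R]_(n.+1 + n.+1) := diag_mx (row_mx g g).

Lemma paired_diag_block g :
  paired_diag g = block_mx (diag_mx g) 0 0 (diag_mx g).
Proof. exact: diag_mx_row. Qed.

Lemma paired_diagD g1 g2 :
  paired_diag (g1 + g2) = paired_diag g1 + paired_diag g2.
Proof. by rewrite /paired_diag -raddfD/= add_row_mx. Qed.

Lemma paired_diagZ c g : paired_diag (c *: g) = c *: paired_diag g.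
Proof. by rewrite /paired_diag -linearZ/= scale_row_mx. Qed.

Lemma paired_diag0 : paired_diag 0 = 0.
Proof. by rewrite /paired_diag row_mx0 raddf0. Qed.

Lemma paired_diag_sum m (c : 'I_m -> R) (g : 'I_m -> 'rV[R]_n.+1) :
  \sum_j c j *: paired_diag (g j) = paired_diag (\sum_j c j *: g j).
Proof.
rewrite (big_morph _ paired_diagD paired_diag0).
by apply: eq_bigr => j _; rewrite paired_diagZ.
Qed.

Lemma paired_diag_inj : injective paired_diag.
Proof.
move=> g1 g2 /matrixP g12; apply/rowP => r.
have := g12 (lshift _ r) (lshift _ r).
by rewrite ![diag_mx _ _ _]mxE eqxx !row_mxEl.
Qed.

Lemma paired_diagM g1 g2 :
  paired_diag g1 *m paired_diag g2 = paired_diag (\row_r (g1 0 r * g2 0 r)).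
Proof.
rewrite /paired_diag mulmx_diag; congr diag_mx; apply/rowP => k; rewrite !mxE.
by case: splitP => r _; rewrite mxE.
Qed.

Lemma paired_diagE g :
  paired_diag g = \sum_r g 0 r *:
    (tensor_product (basis_vector (qidx r)) (basis_covector (qidx r))
     + tensor_product (basis_vector (pidx r)) (basis_covector (pidx r))).
Proof.
rewrite /paired_diag diag_mx_sum_delta big_split_ord/= -big_split/=.
apply: eq_bigr => r _.
by rewrite row_mxEl row_mxEr scalerDr /tensor_product !mul_delta_mx.
Qed.

Lemma canonical_form_block (x : 'cV[R]_(n.+1 + n.+1)) :
  canonical_form x = block_mx 0 (- 1%:M) 1%:M 0.
Proof.
pose E (i j : 'I_(n.+1 + n.+1)) : 'M[R]_(n.+1 + n.+1) := delta_mx i j.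
have -> : canonical_form x =
    \sum_i (E (pidx i) (qidx i) - E (qidx i) (pidx i)).
  by apply: eq_bigr => i _; rewrite /wedge !trmx_delta !mul_delta_mx.
apply/matrixP => s t; rewrite summxE.
case: (split_ordP s) => i ->; case: (split_ordP t) => j ->;
  rewrite ?block_mxEul ?block_mxEur ?block_mxEdl ?block_mxEdr !mxE;
  under eq_bigr => k _ do
    rewrite !mxE ?eq_lshift ?eq_rshift ?eq_lrshift ?eq_rlshift ?andbF ?subr0 ?sub0r/=.
- by rewrite big1// subr0.
- rewrite sumrN; congr (- _).
  rewrite (bigD1 i)//= eqxx eq_sym/= big1 ?addr0// => k /negPf.
  by rewrite eq_sym => ->.
- rewrite (bigD1 i)//= eqxx eq_sym/= big1 ?addr0// => k /negPf.
  by rewrite eq_sym => ->.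
- by rewrite big1// subr0.
Qed.

(** The matrix of the form squares to [-1], so its inverse is its opposite. *)
Lemma canonical_form_unit (x : 'cV[R]_(n.+1 + n.+1)) :
  canonical_form x \in unitmx.
Proof.
suff /mulmx1_unit[] : canonical_form x *m - canonical_form x = 1%:M by [].
rewrite canonical_form_block opp_block_mx mulmx_block.
rewrite !oppr0 !mulmx0 !mul0mx !mulmxN !mulNmx !mulmx1 !opprK !addr0 !add0r.
by rewrite -scalar_mx_block.
Qed.

Lemma canonical_form_tr (x : 'cV[R]_(n.+1 + n.+1)) :
  (canonical_form x)^T = - canonical_form x.
Proof.
rewrite canonical_form_block tr_block_mx opp_block_mx !trmx0 !oppr0.
by rewrite raddfN/= trmx1 opprK.
Qed.

Lemma canonical_form_symplectic (U : set 'cV[R]_(n.+1 + n.+1)) :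
  open U -> symplectic_manifold U canonical_form.
Proof.
move=> oU; split=> //.
- exact: smooth_cst.
- by move=> x _; exact: canonical_form_tr.
- by move=> x _; exact: canonical_form_unit.
- by move=> i j k x _; rewrite /partial !derive_cst !addr0.
Qed.

(** The form exchanges the [q] and [p] blocks, and both carry the same diagonal [g]. This is the
    matrix version of the compatibility of the operator with the form. *)
Lemma paired_diag_canonical_form g (x : 'cV[R]_(n.+1 + n.+1)) :
  canonical_form x *m paired_diag g = (paired_diag g)^T *m canonical_form x.
Proof.
rewrite /paired_diag tr_diag_mx -/(paired_diag g) paired_diag_block.
rewrite canonical_form_block !mulmx_block.
rewrite !mulmx0 !mul0mx !mulNmx !mulmxN !mulmx1 !mul1mx !addr0 !add0r.
done.
Qed.

(** The algebra is described by its eigenvalues rather than as the span of the [K_j]: closure under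
    products is then immediate, and a basis statement identifies it with that span. *)
Definition paired_diag_algebra (U : set 'cV[R]_(n.+1 + n.+1)) :
    set (tensor11 R (n.+1 + n.+1)) :=
  [set T | exists g : 'cV[R]_(n.+1 + n.+1) -> 'rV[R]_n.+1,
     (forall r, smooth_on U (fun x => g x 0 r)) /\
     (forall x, U x -> T x = paired_diag (g x))].

Variables (U : set 'cV[R]_(n.+1 + n.+1)) (m : nat)
  (K : 'I_m -> tensor11 R (n.+1 + n.+1)).
Hypotheses (oU : open U) (K_basis : module_basis U (paired_diag_algebra U) K).

Lemma paired_diag_omega_haantjes :
  omega_haantjes_manifold U canonical_form (paired_diag_algebra U) m.
Proof.
split; first exact: canonical_form_symplectic.
- split; last by exists K.
  split.
  + exists (fun=> paired_diag 0), (fun=> 0); split=> // r; exact: smooth_cst.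
  + move=> T [g [sg TE]]; apply: (haantjes_diagonal oU TE) => i.
    case: (split_ordP i) => r ->.
      rewrite (_ : (fun x => _) = fun x => g x 0 r) //.
      by apply/funext => x; rewrite row_mxEl.
    rewrite (_ : (fun x => _) = fun x => g x 0 r) //.
    by apply/funext => x; rewrite row_mxEr.
  + by move=> T T' [g [sg TE]] TT'; exists g; split=> // x Ux; rewrite -TT'// TE.
  + move=> T1 T2 c1 c2 [g1 [sg1 T1E]] [g2 [sg2 T2E]] sc1 sc2.
    exists (fun x => c1 x *: g1 x + c2 x *: g2 x); split=> [r|x Ux].
      rewrite (_ : (fun x => _) = fun x => c1 x * g1 x 0 r + c2 x * g2 x 0 r).
        by apply: smoothD => //; exact: smoothM.
      by apply/funext => x; rewrite !mxE.
    by rewrite T1E// T2E// paired_diagD !paired_diagZ.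
  + move=> T1 T2 [g1 [sg1 T1E]] [g2 [sg2 T2E]].
    exists (fun x => \row_r (g1 x 0 r * g2 x 0 r)); split=> [r|x Ux].
      rewrite (_ : (fun x => _) = fun x => g1 x 0 r * g2 x 0 r).
        exact: smoothM.
      by apply/funext => x; rewrite !mxE.
    by rewrite T1E// T2E// paired_diagM.
- move=> T1 T2 [g1 [_ T1E]] [g2 [_ T2E]] x Ux.
  by rewrite T1E// T2E// /paired_diag diag_mxC.
- move=> T [g [_ TE]] X Y _ _ x Ux; rewrite /eval02 /apply11 TE//.
  congr (_ 0 0).
  by rewrite mulmxA -(mulmxA _ _ (paired_diag _)) paired_diag_canonical_form
    trmx_mul !mulmxA.
Qed.

End PairedDiagonal.

(** * The lifted Staeckel system *)

Section StackelSystem.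
Context {R : realType} {n : nat}.
Variables (V : set 'cV[R]_n) (S : 'I_n -> 'I_n -> R -> R)
  (a : 'I_n -> R -> R -> R) (b : R -> R) (f : 'I_n.+1 -> R -> R -> R).
Hypotheses (V_open : open V)
  (S_smooth : forall i k, smooth_on (qrange V (lift ord_max i)) (S i k))
  (S_invertible : forall v, V v -> stackel_matrix S v \in unitmx)
  (a_smooth : forall i, smooth_on (qrange V (lift ord_max i) `*` [set: R])
     (fun z : R * R => a i z.1 z.2))
  (b_smooth : smooth_on (qrange V ord_max) b)
  (b_neq0 : forall t, qrange V ord_max t -> b t != 0)
  (f_smooth : forall r, smooth_on (qrange V r `*` [set: R])
     (fun z : R * R => f r z.1 z.2)).

Local Notation phase := 'cV[R]_(n.+1 + n.+1).
Local Notation P := (lifted_phase_space V).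
Local Notation L := (lifted_matrix S a b).
Local Notation U := (lifted_domain V S a b f).
Local Notation H := (lifted_hamiltonian S a b f).
Local Notation K := (lifted_operator S a b).
Local Notation mu := (lifted_mu S a b).

Lemma open_lifted_phase_space : open P.
Proof.
have sq : smooth_on [set: phase]
    (fun x => \col_(i < n) qcoord x (lift ord_max i)).
  apply: smooth_mx => [|i j]; first exact: openT.
  have [l cl lE] := coord_linear_continuous R (qidx (lift ord_max i)) (0 : 'I_1).
  apply: (smooth_eq openT (f := l)) => [x _|]; first by rewrite lE mxE.
  exact: (smooth_linear (openT : open [set: phase]) cl).
rewrite (_ : P = (fun x => \col_(i < n) qcoord x (lift ord_max i)) @^-1` V) //.
apply: open_comp => // x _.
exact: (smooth_continuous sq I).
Qed.
Local Notation oP := open_lifted_phase_space.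

Lemma qrangeP x r : P x -> qrange V r (x (qidx r) 0).
Proof. by exists x. Qed.

Lemma smooth_lifted_matrix r j : smooth_on P (fun x => L x r j).
Proof.
apply: (smooth_eq oP (f := fun x => match unlift ord_max r, unlift ord_max j with
    | Some i, Some k => S i k (qcoord x r)
    | Some i, None => a i (qcoord x r) (pcoord x r)
    | None, Some _ => 0
    | None, None => b (qcoord x r)
    end)) => [x _|]; first by rewrite mxE.
case: unliftP => [i ->|->]; case: unliftP => [k _|_].
- exact: (smooth_comp_coord oP (fun x => qrangeP _) (S_smooth i k)).
- apply: (smooth_comp_coord2 oP _ (a_smooth i)) => x Px.
  by split=> //=; exact: qrangeP.
- exact: smooth_cst.
- exact: (smooth_comp_coord oP (fun x => qrangeP _) b_smooth).
Qed.

Lemma smooth_forcing r : smooth_on P (fun x => f r (qcoord x r) (pcoord x r)).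
Proof.
apply: (smooth_comp_coord2 oP _ (f_smooth r)) => x Px.
by split=> //=; exact: qrangeP.
Qed.

(** The only nonzero entry of the last row is the value of [b], and its minor is the invertible
    Stäckel matrix. *)
Lemma det_lifted_matrix_neq0 x : P x -> \det (L x) != 0.
Proof.
move=> Px; rewrite (expand_det_row _ ord_max) (bigD1 ord_max)//= big1.
  rewrite addr0 mxE unlift_none mulf_neq0 ?b_neq0//; first exact: qrangeP.
  rewrite /cofactor mulf_neq0 ?signr_eq0//.
  have -> : row' ord_max (col' ord_max (L x))
      = stackel_matrix S (\col_(i < n) qcoord x (lift ord_max i)).
    by apply/matrixP => i k; rewrite !mxE !liftK.
  by rewrite -unitfE -unitmxE; exact: S_invertible.
move=> j jmax; rewrite mxE unlift_none.
by case: unliftP jmax => [k _|->]; rewrite ?mul0r// eqxx.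
Qed.

Lemma smooth_lifted_cofactor j r : smooth_on P (lifted_cofactor S a b j r).
Proof. by apply: (smooth_cofactor oP) => s k; exact: smooth_lifted_matrix. Qed.

(** Cramer's rule rewrites the inverse matrix through cofactors, from which smoothness can be read
    off. *)
Lemma lifted_hamiltonianE j x : P x ->
  H j x = (\det (L x))^-1
    * \sum_r lifted_cofactor S a b j r x * f r (qcoord x r) (pcoord x r).
Proof.
move=> Px; have dL := det_lifted_matrix_neq0 Px.
rewrite /lifted_hamiltonian /invmx unitmxE unitfE dL -scalemxAl mxE mxE.
by congr (_ * _); apply: eq_bigr => r _; rewrite !mxE.
Qed.

Lemma smooth_lifted_hamiltonian j : smooth_on P (H j).
Proof.
apply: (smooth_eq oP (f := fun x => (\det (L x))^-1
    * \sum_r lifted_cofactor S a b j r x * f r (qcoord x r) (pcoord x r))).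
  by move=> x Px; rewrite lifted_hamiltonianE.
apply: (smoothM oP).
  apply: (smoothV oP det_lifted_matrix_neq0).
  exact: (smooth_det oP smooth_lifted_matrix).
apply: (smooth_sum oP) => r; apply: (smoothM oP).
  exact: smooth_lifted_cofactor.
exact: smooth_forcing.
Qed.

Lemma lifted_domain_sub : U `<=` P. Proof. by move=> x []. Qed.

Lemma open_lifted_domain : open U.
Proof.
(* The two families of nonvanishing conditions are indexed by one sum type, so that [open_neq0]
   handles them together. *)
have sg (i : 'I_n.+1 + 'I_n.+1) : smooth_on P (match i with
    | inl r => lifted_cofactor S a b ord0 r
    | inr r => partial (pidx r) (H ord0) end).
  case: i => r; first exact: smooth_lifted_cofactor.
  exact: (smooth_derive _ (smooth_lifted_hamiltonian _)).
have := open_neq0 oP sg; congr open; apply/seteqP; split=> x /=.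
  by move=> [Px h]; split=> // r; [exact: (h (inl r))|exact: (h (inr r))].
by move=> [Px h1 h2]; split=> // -[r|r]; [exact: h1|exact: h2].
Qed.
Local Notation oU := open_lifted_domain.

Lemma smooth_lifted_mu j r : smooth_on U (mu j r).
Proof.
apply: (smoothM oU).
  exact: (smooth_subset lifted_domain_sub (smooth_lifted_cofactor _ _)).
apply: (smoothV oU); first by move=> x [_ + _]; exact.
exact: (smooth_subset lifted_domain_sub (smooth_lifted_cofactor _ _)).
Qed.

Lemma lifted_operatorE j x : K j x = paired_diag (\row_r mu j r x).
Proof. by rewrite paired_diagE; apply: eq_bigr => r _; rewrite mxE. Qed.

(* Only the last row of the lifted matrix sees q^{n+1}, and it does so through
   a common factor, which cancels in the quotient of cofactors. *)
Lemma lifted_mu_dep j r x y : P x -> U y ->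
  (forall i : 'I_n, qcoord x (lift ord_max i) = qcoord y (lift ord_max i)) ->
  (forall i : 'I_n, pcoord x (lift ord_max i) = pcoord y (lift ord_max i)) ->
  mu j r x = mu j r y.
Proof.
move=> Px [Py cy _] qxy pxy.
pose d : 'rV[R]_n.+1 := \row_s
  if s == ord_max then b (qcoord y ord_max) / b (qcoord x ord_max) else 1.
have Ly : L y = diag_mx d *m L x.
  apply/matrixP => s k; rewrite mul_diag_mx !mxE.
  case: (unliftP ord_max s) => [i ->|->].
    rewrite eq_sym (negPf (neq_lift _ _)) mul1r qxy pxy.
    by case: unliftP.
  rewrite eqxx; case: unliftP => [? _|_]; first by rewrite mulr0.
  by rewrite divfK//; exact: b_neq0 (qrangeP _ Px).
(* The nonzero cofactor at [y] contains the product of scaling factors, which is therefore nonzero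
   and can be cancelled. *)
have := cy r; rewrite /lifted_mu /lifted_cofactor Ly !cofactor_diag_mul.
rewrite mulf_eq0 negb_or => /andP[c0 _].
by rewrite -[RHS]mulf_div divff// mul1r.
Qed.

(* Differentiating L H = F in the direction of q^r or p_r only involves
   the r-th row. *)
Lemma partial_lifted_hamiltonian c r j x : c \in [:: qidx r; pidx r] -> P x ->
  partial c (H j) x * lifted_cofactor S a b ord0 r x
  = partial c (H ord0) x * lifted_cofactor S a b j r x.
Proof.
move=> cr Px; have dL := det_lifted_matrix_neq0 Px.
have coordE s (h : R) : s != r ->
    qcoord (h *: basis_vector c + x) s = qcoord x s
    /\ pcoord (h *: basis_vector c + x) s = pcoord x s.
  move=> sr; rewrite /qcoord /pcoord !mxE !eqxx !andbT.
  have -> : qidx s == c = false.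
    by move: cr; rewrite !inE => /orP[] /eqP->;
      rewrite ?eq_lshift ?eq_lrshift ?(negPf sr).
  have -> : pidx s == c = false.
    by move: cr; rewrite !inE => /orP[] /eqP->;
      rewrite ?eq_rshift ?eq_rlshift ?(negPf sr).
  by rewrite mulr0 !add0r.
have LH s y : P y ->
    \sum_j L y s j * H j y = f s (qcoord y s) (pcoord y s).
  move=> Py; have /(congr1 (fun M : 'cV[R]_n.+1 => M s 0)) : L y *m
      (invmx (L y) *m \col_r f r (qcoord y r) (pcoord y r))
      = \col_r f r (qcoord y r) (pcoord y r).
    by rewrite mulKVmx// unitmxE unitfE det_lifted_matrix_neq0.
  by rewrite !mxE.
pose dH k := partial c (H k) x.
(* For [s != r], both the entries of row [s] and the right-hand side are invariant under translation
   along coordinate [c], so the Leibniz rule leaves only the terms with derivatives of the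
   Hamiltonians. *)
have row0 s : s != r -> \sum_k L x s k * dH k = 0.
  move=> sr.
  have dLH k : partial c ((fun y => L y s k) * H k) x = L x s k * dH k.
    rewrite /partial deriveM; last 2 first.
    - exact/diff_derivable/(smooth_differentiable (smooth_lifted_matrix _ _) Px).
    - exact/diff_derivable/(smooth_differentiable (smooth_lifted_hamiltonian _) Px).
    rewrite [X in _ + _ *: X](_ : _ = 0) ?scaler0 ?addr0//.
    apply: derive_translation_invariant => h.
    by have [qE pE] := coordE s h sr; rewrite !mxE qE pE.
  under eq_bigr do rewrite -dLH.
  rewrite /partial -derive_sum; last first.
    move=> k; apply: derivableM; apply/diff_derivable.
      exact: smooth_differentiable (smooth_lifted_matrix _ _) Px.
    exact: smooth_differentiable (smooth_lifted_hamiltonian _) Px.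
  rewrite (near_eq_derive (g := fun y => f s (qcoord y s) (pcoord y s))).
    apply: derive_translation_invariant => h.
    by have [-> ->] := coordE s h sr.
  apply: filterS (open_nbhs_nbhs (conj oP Px)) => y Py.
  by rewrite fct_sumE; exact: LH.
have LdH s : (L x *m \col_l dH l) s 0 = \sum_l L x s l * dH l.
  by rewrite mxE; apply: eq_bigr => l _; rewrite [(\col_k dH k) l 0]mxE.
(* Multiplying by the adjugate recovers [dH]; since [L dH] has only its entry [r] left, a single
   column of cofactors remains. *)
have dHE k : \det (L x) * dH k
    = lifted_cofactor S a b k r x * \sum_l L x r l * dH l.
  transitivity ((\adj (L x) *m (L x *m \col_l dH l)) k 0).
    by rewrite mulmxA mul_adj_mx mul_scalar_mx [RHS]mxE [(\col_l dH l) k 0]mxE.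
  rewrite mxE (bigD1 r)//= big1 => [|s sr]; last by rewrite LdH row0// mulr0.
  by rewrite addr0 LdH [(\adj _) _ _]mxE.
apply: (mulfI dL); rewrite [LHS]mulrA [RHS]mulrA.
by rewrite [X in X * _ = _](dHE j) [X in _ = X * _](dHE ord0) mulrAC [RHS]mulrAC
  (mulrC (lifted_cofactor _ _ _ j _ _)).
Qed.

Lemma exterior_derivative_hamiltonian j x : U x ->
  exterior_derivative (H j) x
  = transpose_apply (K j) (exterior_derivative (H ord0)) x.
Proof.
move=> [Px c0 _]; apply/rowP => c.
rewrite /transpose_apply lifted_operatorE mul_mx_diag [RHS]mxE.
rewrite ![exterior_derivative _ _ _ _]mxE.
have main r : c \in [:: qidx r; pidx r] ->
    partial c (H j) x = partial c (H ord0) x * mu j r x.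
  move=> cr; apply: (mulIf (c0 r)); rewrite -mulrA divfK ?c0//.
  exact: partial_lifted_hamiltonian.
case: (split_ordP c) main => r -> main.
  by rewrite row_mxEl [(\row__ _) _ _]mxE (main r)// inE eqxx.
by rewrite row_mxEr [(\row__ _) _ _]mxE (main r)// !inE eqxx orbT.
Qed.

(** * Invertibility of the eigenvalue matrix, the module basis and the chain *)

Let M x : 'M[R]_n.+1 := \matrix_(j, r) mu j r x.
(** The matrix [M] is the adjugate of [L] with column [r] divided by its first cofactor. Its inverse
    is thus [L] over its determinant with row [s] multiplied by that cofactor, an explicit smooth
    expression. *)
Let W x : 'M[R]_n.+1 := \matrix_(s, j)
  (lifted_cofactor S a b ord0 s x * L x s j / \det (L x)).

Lemma mulWM x : U x -> W x *m M x = 1%:M.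
Proof.
move=> [Px c0 _]; have dL := det_lifted_matrix_neq0 Px.
apply/matrixP => s r; rewrite mxE [RHS]mxE.
transitivity (lifted_cofactor S a b ord0 s x / (\det (L x) *
    lifted_cofactor S a b ord0 r x) * \sum_j L x s j * lifted_cofactor S a b j r x).
  rewrite mulr_sumr; apply: eq_bigr => j _.
  by rewrite [W _ _ _]mxE [M _ _ _]mxE /lifted_mu [in RHS]invfM; ring.
rewrite mul_adj_entry; case: eqVneq => [->|_]; last by rewrite mulr0n mulr0.
by rewrite !mulr1n; field; rewrite c0 dL.
Qed.

Lemma mulMW x : U x -> M x *m W x = 1%:M.
Proof. by move=> Ux; apply: mulmx1C; exact: mulWM. Qed.

Lemma combination_lifted_operator (c : 'I_n.+1 -> R) x :
  \sum_j c j *: K j x = paired_diag ((\row_j c j) *m M x).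
Proof.
under eq_bigr do rewrite lifted_operatorE.
rewrite paired_diag_sum; congr paired_diag; apply/rowP => r.
by rewrite summxE mxE; apply: eq_bigr => j _; rewrite !mxE.
Qed.

Lemma lifted_operator_basis : module_basis U (paired_diag_algebra U) K.
Proof.
split.
- move=> j; exists (fun x => \row_r mu j r x); split=> [r|x _].
    rewrite (_ : (fun x => _) = mu j r); first exact: smooth_lifted_mu.
    by apply/funext => x; rewrite mxE.
  exact: lifted_operatorE.
(* The coefficients solve [c M = g], so [c = g W]; the closed form of [W] makes them smooth. *)
- move=> T [g [sg TE]]; exists (fun j x => (g x *m W x) 0 j); split=> [j|x Ux].
    apply: (smooth_eq oU (f := fun x => \sum_s g x 0 s * (lifted_cofactor S a b
        ord0 s x * L x s j * (\det (L x))^-1))).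
      by move=> x _; rewrite [RHS]mxE; apply: eq_bigr => s _; rewrite [W _ _ _]mxE.
    apply: (smooth_sum oU) => s; apply: (smoothM oU); first exact: sg.
    apply: (smooth_subset lifted_domain_sub); apply: (smoothM oP).
      apply: (smoothM oP); first exact: smooth_lifted_cofactor.
      exact: smooth_lifted_matrix.
    apply: (smoothV oP det_lifted_matrix_neq0).
    exact: (smooth_det oP smooth_lifted_matrix).
  rewrite combination_lifted_operator (TE _ Ux); congr paired_diag.
  rewrite (_ : \row_j _ = g x *m W x); last by apply/rowP => j; rewrite mxE.
  by rewrite -mulmxA mulWM// mulmx1.
- move=> c _ cK0 j x Ux; have := cK0 x Ux.
  rewrite combination_lifted_operator -paired_diag0 => /paired_diag_inj cM.
  have : (\row_j c j x) *m M x *m W x = 0 by rewrite cM mul0mx.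
  by rewrite -mulmxA mulMW// mulmx1 => /rowP/(_ j); rewrite !mxE.
Qed.

Lemma lifted_operator_chain : generates_haantjes_chain U (paired_diag_algebra U)
  K (H ord0).
Proof.
have sH j : smooth_on U (H j).
  exact: (smooth_subset lifted_domain_sub (smooth_lifted_hamiltonian _)).
split.
- exact: sH.
- exact: lifted_operator_basis.
- move=> j; split.
    apply: (smooth_eq oU (f := exterior_derivative (H j))) => [x Ux|].
      exact: exterior_derivative_hamiltonian.
    apply: (smooth_mx oU) => i c.
    apply: (smooth_eq oU (f := partial c (H j))) => [x _|]; first by rewrite mxE.
    exact: (smooth_derive _ (sH j)).
  move=> i k x Ux.
  (* Near [x] the form is [dH_j], so closedness becomes the symmetry of the second derivatives of
     [H_j]. *)
  have E c l : partial c
      (fun y => transpose_apply (K j) (exterior_derivative (H ord0)) y 0 l) x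
      = 'D_(basis_vector c) (fun y => 'D_(basis_vector l) (H j) y) x.
    apply: near_eq_derive.
    apply: filterS (open_nbhs_nbhs (conj oU Ux)) => y Uy.
    by rewrite -exterior_derivative_hamiltonian// mxE.
  by rewrite (E i k) (E k i); exact: derive_sym oU (sH j 2%N) Ux.
- move=> x Ux; have [Px c0 p0] := Ux.
  set D := (X in row_free X).
  (* Multiplication by [col_mx 0 1%:M] selects the momentum columns. They form [M] times the
     diagonal of the derivatives of [H_1] along the momenta, which are nonzero on [U]; an invertible
     block forces full row rank. *)
  have DE : D *m col_mx 0 1%:M
      = M x *m diag_mx (\row_r partial (pidx r) (H ord0) x).
    rewrite -[D]hsubmxK mul_row_col mulmx0 add0r mulmx1.
    apply/matrixP => j r; rewrite mul_mx_diag [LHS]mxE [RHS]mxE [D _ _]mxE.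
    rewrite /transpose_apply lifted_operatorE mul_mx_diag [LHS]mxE row_mxEr.
    rewrite [exterior_derivative _ _ _ _]mxE ![(\row__ _) _ _]mxE.
    by rewrite [M _ _ _]mxE mulrC.
  have : M x *m diag_mx (\row_r partial (pidx r) (H ord0) x) \in unitmx.
    rewrite unitmx_mul; have [_ ->]/= := mulmx1_unit (mulWM Ux).
    rewrite unitmxE unitfE det_diag; apply/prodf_neq0 => r _.
    by rewrite mxE p0.
  rewrite -row_free_unit -DE /row_free => /eqP rk.
  by rewrite eqn_leq rank_leq_row -{1}rk mxrankM_maxl.
Qed.

End StackelSystem.

Theorem theorem2 (R : realType) (n : nat) (V : set 'cV[R]_n)
    (S : 'I_n -> 'I_n -> R -> R) (a : 'I_n -> R -> R -> R) (b : R -> R)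
    (f : 'I_n.+1 -> R -> R -> R)
    (V_open : open V)
    (S_smooth : forall i k, smooth_on (qrange V (lift ord_max i)) (S i k))
    (S_invertible : forall v, V v -> stackel_matrix S v \in unitmx)
    (a_smooth : forall i,
       smooth_on (qrange V (lift ord_max i) `*` [set: R])
         (fun z : R * R => a i z.1 z.2))
    (b_smooth : smooth_on (qrange V ord_max) b)
    (b_neq0 : forall t, qrange V ord_max t -> b t != 0)
    (f_smooth : forall r,
       smooth_on (qrange V r `*` [set: R]) (fun z : R * R => f r z.1 z.2)) :
  let U := lifted_domain V S a b f in
  let H := lifted_hamiltonian S a b f in
  let K := lifted_operator S a b in
  (forall j r x y, U x -> U y ->
     (forall i : 'I_n, qcoord x (lift ord_max i) = qcoord y (lift ord_max i)) ->
     (forall i : 'I_n, pcoord x (lift ord_max i) = pcoord y (lift ord_max i)) ->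
     lifted_mu S a b j r x = lifted_mu S a b j r y) /\
  exists A : set (tensor11 R (n.+1 + n.+1)),
    [/\ omega_haantjes_manifold U canonical_form A n.+1,
        module_basis U A K,
        forall j, semisimple U (K j),
        generates_haantjes_chain U A K (H ord0)
      & potential_functions U K (H ord0) H].
Proof.
have oU := open_lifted_domain V_open S_smooth S_invertible a_smooth b_smooth
  b_neq0 f_smooth.
have basis := lifted_operator_basis V_open S_smooth S_invertible a_smooth
  b_smooth b_neq0 f_smooth.
move=> U H K; split=> [j r x y [Px _ _] Uy|].
  exact: (lifted_mu_dep b_neq0 j r Px Uy).
(* Using the pair-diagonal algebra as witness, the rank [n.+1] comes from the basis formed by the
   [K_j]. *)
exists (paired_diag_algebra U); split.
- exact: (paired_diag_omega_haantjes oU basis).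
- exact: basis.
- by move=> j x _; rewrite /K lifted_operatorE; exact: diagonalizable_diag.
- exact: lifted_operator_chain.
- move=> j; split.
    apply: (smooth_subset (@lifted_domain_sub _ _ V S a b f)).
    exact: smooth_lifted_hamiltonian.
  move=> x Ux; exact: (exterior_derivative_hamiltonian V_open S_smooth
    S_invertible a_smooth b_smooth b_neq0 f_smooth _ Ux).
Qed.
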